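(* Let $N\ge1$, $\beta>0$, $\mu>0$, and consider the Markovian SIR epidemic $\{(S_t,I_t)\}_{t\ge0}$ killed at $\hat\tau=\inf\{t>0: I_t\le1,\ S_t\le N-1\}$ (first return to level $i\le1$ after leaving $(N,1)$), with transient set $\hat S=\{(N,1)\}\cup\{(s,i)\in\mathbb{Z}^2:0\le s\le N,\ 2\le i\le N+1-s\}$. Then there exists a quasi-stationary distribution $\hat\nu$ on $\hat S$ for this killed process with $\hat\nu(N,1)>0$ (a non-trivial QSD) if and only if $\mu>\beta N$. In that case $\hat\nu$ is the unique QSD charging $(N,1)$, $\hat\nu(s,i)>0$ for every $(s,i)\in\hat S$, and $$\lim_{t\to\infty}P_{(N,1)}(S_t=s,\,I_t=i\mid\hat\tau>t)=\hat\nu(s,i),\quad (s,i)\in\hat S.$$ Moreover, for any probability distribution $\rho$ on $\hat S$ with $\rho(N,1)=0$, $\lim_{t\to\infty}P_\rho(S_t=s,\,I_t=i\mid\hat\tau>t)=\delta_{(0,2)}(s,i)$.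
   Context: SIR model: population of size $N+1$; $S_t$, $I_t$ are the numbers of susceptible and infected individuals. It is the continuous-time Markov chain on $\{(s,i)\in\mathbb{Z}^2:0\le s\le N,\ 0\le i\le N+1-s\}$ with transitions from $(S,I)$: $(S-1,I+1)$ at rate $\beta SI$ and $(S,I-1)$ at rate $\mu I$ (total rate $I(\beta S+\mu)$). A QSD for the killed process is a probability measure $\nu$ on $\hat S$ with $P_\nu((S_t,I_t)\in A\mid\hat\tau>t)=\nu(A)$ for all $t\ge0$, $A\subset\hat S$.
   Formalization: The killing time is taken as the exit time from Ŝ, so the state (N,0) also kills; under the literal formula (S_t ≤ N−1) the absorbing state (N,0) would never be killed and no quasi-stationary distribution charging (N,1) could exist. *)

(* Defs.v *)
From HB Require Import structures.
From mathcomp Require Import all_boot all_order all_algebra.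
From mathcomp Require Import all_classical all_reals all_analysis.
Set Implicit Arguments. Unset Strict Implicit. Unset Printing Implicit Defensive.
Import Order.TTheory GRing.Theory Num.Theory.
Local Open Scope ring_scope.

Definition stT (N : nat) := ('I_N.+1 * 'I_N.+2)%type.

Definition inShat (N : nat) (x : stT N) : bool :=
  (((x.1 : nat) == N) && ((x.2 : nat) == 1%N)) ||
  ((2 <= (x.2 : nat))%N && ((x.1 : nat) + (x.2 : nat) <= N.+1)%N).
Definition Shat (N : nat) : {set stT N} := [set x | inShat x].

Definition xN1 (N : nat) : stT N := (ord_max, inord 1).
Definition x02 (N : nat) : stT N := (ord0, inord 2).

Section SIR.
Variables (R : realType) (N : nat) (beta mu : R).

Definition rate (x y : stT N) : R :=
  if ((y.1 : nat).+1 == x.1) && ((y.2 : nat) == (x.2 : nat).+1)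
  then beta * (x.1 : nat)%:R * (x.2 : nat)%:R
  else if ((y.1 : nat) == x.1) && ((y.2 : nat).+1 == x.2)
  then mu * (x.2 : nat)%:R else 0.

Definition totrate (x : stT N) : R := (x.2 : nat)%:R * (beta * (x.1 : nat)%:R + mu).

(* Sub-generator of the process killed on leaving hat S (rows/columns
   outside hat S are set to 0 and never used). *)
Definition Qk (x y : stT N) : R :=
  if (x \in Shat N) && (y \in Shat N) then
    (if x == y then - totrate x else rate x y)
  else 0.

Fixpoint Qpow (k : nat) : stT N -> stT N -> R :=
  match k with
  | 0%N => fun x y => (x == y)%:R
  | k.+1 => fun x y => \sum_(z : stT N) Qk x z * Qpow k z y
  end.

(* Transition function of the killed process:
   Pk t x y = P_x((S_t,I_t) = y, tauhat > t) = exp(t Q)_{x y}. *)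
Definition Pk (t : R) (x y : stT N) : R :=
  limn (fun n : nat => \sum_(k < n) (t ^+ k / (k`!)%:R) * Qpow k x y).

Definition isProbShat (nu : stT N -> R) : Prop :=
  (forall x, 0 <= nu x) /\ (forall x, x \notin Shat N -> nu x = 0) /\
  \sum_(x in Shat N) nu x = 1.

Definition condP (nu : stT N -> R) (t : R) (A : {set stT N}) : R :=
  (\sum_(x in Shat N) nu x * \sum_(y in A) Pk t x y) /
  (\sum_(x in Shat N) nu x * \sum_(y in Shat N) Pk t x y).

Definition isQSD (nu : stT N -> R) : Prop :=
  isProbShat nu /\
  forall t : R, 0 <= t -> forall A : {set stT N}, A \subset Shat N ->
    condP nu t A = \sum_(y in A) nu y.

Definition dirac_st (x0 : stT N) : stT N -> R := fun x => (x == x0)%:R.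

End SIR.

(* Main.v *)
Require Import Defs.
From HB Require Import structures.
From mathcomp Require Import all_boot all_order all_algebra.
From mathcomp Require Import all_classical all_reals all_analysis.
From mathcomp Require Import ring lra zify.
Import Order.TTheory GRing.Theory Num.Theory.
Import numFieldNormedType.Exports.
Local Open Scope classical_set_scope.
Local Open Scope ring_scope.

(** Every jump of the SIR chain lowers [2 s + i] by exactly one, so the
    sub-generator [Q] is triangular with diagonal entries [- q(s, i)].  The
    forward equations for [u(t) = rho exp(tQ)] can thus be treated one state at
    a time: [exp(a t) u_y] solves [h' = k - (q_y - a) h], where [k] is the scaled
    inflow from states of higher rank, and if [k] tends to [c] and [a < q_y], then
    [h] tends to [c / (q_y - a)].

    With [a = q(N,1) = beta N + mu], the scaled mass at [(N,1)] is constant.  If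
    [beta N < mu], then [a < 2 mu <= q_y] for every other state, so
    [exp(a t) u(t)] converges to a multiple of the positive left eigenvector of
    [Q] for [- a], which gives existence, uniqueness and the conditional limit.
    Conversely a QSD charging [(N,1)] is a left eigenvector for [- a], necessarily
    positive, and its equation at [(0,2)] forces [a < q(0,2) = 2 mu].

    Without mass at [(N,1)] one takes [a = 2 mu]: all scaled masses tend to [0]
    except that of [(0,2)], the unique state of minimal rate among those with
    [i >= 2], which is nondecreasing and eventually positive. *)

Section ExponentialGeneratingFunction.
Variable R : realType.
Implicit Types (b : nat -> R) (t : R).

Definition egf b t : R :=
  limn (fun n : nat => \sum_(k < n) (t ^+ k / (k`!)%:R) * b k).

Definition geom_bounded b := exists C M : R, forall k, `|b k| <= C * M ^+ k.

Lemma geom_boundedS b : geom_bounded b -> geom_bounded (fun k => b k.+1).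
Proof.
by move=> [C [M bb]]; exists (C * M), M => k; rewrite -mulrA -exprS.
Qed.

Lemma egf_pseries b t :
  (fun n : nat => \sum_(k < n) (t ^+ k / (k`!)%:R) * b k) =
  pseries (fun k => b k / (k`!)%:R) t.
Proof.
apply/funext => n; rewrite /pseries /series /= big_mkord.
by apply: eq_bigr => k _; ring.
Qed.

Lemma is_cvg_egf b t : geom_bounded b ->
  cvgn (fun n : nat => \sum_(k < n) (t ^+ k / (k`!)%:R) * b k).
Proof.
move=> [C [M bb]]; rewrite egf_pseries; apply: normed_cvg.
have bd k : `|b k| <= `|C| * `|M| ^+ k.
  by rewrite -normrX -normrM (le_trans (bb k))// ler_norm.
apply: (@series_le_cvg _ _ (fun k => `|C| * exp_coeff (`|M| * `|t|) k)).
- by move=> n; apply: normr_ge0.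
- by move=> n; rewrite mulr_ge0// exp_coeff_ge0// mulr_ge0.
- move=> n; rewrite /exp_coeff /= !normrM normrX normfV [X in _ / X]ger0_norm//.
  rewrite exprMn; apply: (@le_trans _ _ (`|C| * `|M| ^+ n / n`!%:R * `|t| ^+ n)).
    by rewrite ler_wpM2r ?exprn_ge0// ler_wpM2r ?invr_ge0.
  by rewrite le_eqVlt; apply/orP; left; apply/eqP; ring.
- exact: is_cvg_seriesZ (is_cvg_series_exp_coeff _).
Qed.

Lemma pseries_diffs_egf b :
  pseries_diffs (fun k => b k / (k`!)%:R) = (fun k => b k.+1 / (k`!)%:R).
Proof.
apply/funext => k; rewrite /pseries_diffs factS natrM invfM.
by rewrite mulrCA mulrA mulrA mulfK ?pnatr_eq0.
Qed.

Lemma is_derive_egf b t : geom_bounded b ->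
  is_derive t (1 : R) (egf b) (egf (fun k => b k.+1) t).
Proof.
move=> bb; rewrite /egf.
have -> : (fun t => limn (fun n : nat => \sum_(k < n) (t ^+ k / (k`!)%:R) * b k))
    = (fun t => limn (pseries (fun k => b k / (k`!)%:R) t)).
  by apply/funext => s; rewrite egf_pseries.
rewrite (egf_pseries (fun k => b k.+1)) -pseries_diffs_egf.
apply: (@pseries_snd_diffs _ _ (`|t| + 1)).
- by rewrite -egf_pseries; apply: (is_cvg_egf _ _ bb).
- by rewrite pseries_diffs_egf -(egf_pseries (fun k => b k.+1)); apply: (is_cvg_egf _ _ (geom_boundedS _ bb)).
- rewrite !pseries_diffs_egf -(egf_pseries (fun k => b k.+2)).
  exact: (is_cvg_egf _ _ (geom_boundedS _ (geom_boundedS _ bb))).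
- by rewrite [X in _ < X]ger0_norm ?ltrDl// addr_ge0.
Qed.

Lemma egf_sum (I : finType) (c : I -> R) (b : I -> nat -> R) t :
  (forall i, geom_bounded (b i)) ->
  egf (fun k => \sum_i c i * b i k) t = \sum_i c i * egf (b i) t.
Proof.
move=> bb; apply: (@cvg_lim R) => //.
rewrite (_ : (fun n : nat => _) = (fun n : nat =>
   \sum_i c i * \sum_(k < n) (t ^+ k / (k`!)%:R) * b i k)); last first.
  apply/funext => n; under [RHS]eq_bigr do rewrite mulr_sumr.
  rewrite [RHS]exchange_big /=; apply: eq_bigr => k _.
  by rewrite mulr_sumr; apply: eq_bigr => i _; ring.
apply: cvg_big => [|i _]; first exact: add_continuous.
by apply: cvgM; [exact: cvg_cst | exact: (is_cvg_egf _ _ (bb i))].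
Qed.

Lemma egf_geom (a c t : R) : egf (fun k => a * c ^+ k) t = a * expR (c * t).
Proof.
apply: (@cvg_lim R) => //.
rewrite (_ : (fun n : nat => _) = (fun n => a * series (exp_coeff (c * t)) n)).
  by apply: cvgM; [exact: cvg_cst | exact: is_cvg_series_exp_coeff].
apply/funext => n; rewrite /series /= big_mkord mulr_sumr.
by apply: eq_bigr => k _; rewrite /exp_coeff /= exprMn; ring.
Qed.

End ExponentialGeneratingFunction.

Section LinearODE.
Variable R : realType.
Implicit Types (f df h k : R -> R).

Lemma MVT_derive f df a b : a < b ->
  (forall x, is_derive x (1 : R) f (df x)) ->
  exists2 c, a < c & f b - f a = df c * (b - a).
Proof.
move=> ab fd; have [|c + E] := MVT ab (fun x _ => fd x).
  by apply: derivable_within_continuous => x _; have [] := fd x.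
by rewrite in_itv /= => /andP[ac _]; exists c.
Qed.

Lemma derive_lt f df a b : a < b ->
  (forall x, is_derive x (1 : R) f (df x)) ->
  (forall x, a < x -> 0 < df x) -> f a < f b.
Proof.
move=> ab fd df0; have [c ac E] := MVT_derive _ _ _ _ ab fd.
by rewrite -subr_gt0 E mulr_gt0 ?df0 ?subr_gt0.
Qed.

Lemma derive_le f df a b : a <= b ->
  (forall x, is_derive x (1 : R) f (df x)) ->
  (forall x, a < x -> 0 <= df x) -> f a <= f b.
Proof.
rewrite le_eqVlt => /predU1P[->//|ab] fd df0.
have [c ac E] := MVT_derive _ _ _ _ ab fd.
by rewrite -subr_ge0 E mulr_ge0 ?df0 ?subr_ge0// ltW.
Qed.

Lemma is_derive_expRM f (a df t : R) : is_derive t (1 : R) f df ->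
  is_derive t (1 : R) (fun x => expR (a * x) * f x)
    (expR (a * t) * (a * f t + df)).
Proof.
move=> fd; have ed : is_derive t (1 : R) (fun x => expR (a * x)) (expR (a * t) * a).
  apply: is_derive1_comp.
  have -> : *%R a = a *: (@id R) by apply/funext.
  by apply: is_derive_eq (is_deriveZ _ (is_derive_id _ _)) _; rewrite /GRing.scale /= mulr1.
apply: is_derive_eq (is_deriveM ed fd) _; rewrite /GRing.scale /=; ring.
Qed.

(* Gronwall: [exp (d t) (h t - e / d)] is eventually nonincreasing. *)
Lemma ode_limsup h k (d e e' : R) : 0 < d -> e < d * e' ->
  (forall t, is_derive t (1 : R) h (k t - d * h t)) ->
  (\forall t \near +oo, k t <= e) -> \forall t \near +oo, h t <= e'.
Proof.
move=> d0 ee' hd [T [Tr kT]].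
pose g t := - (expR (d * t) * (h t - e / d)).
have gd t : is_derive t (1 : R) g (expR (d * t) * (e - k t)).
  have hed : is_derive t (1 : R) (fun x => h x - e / d) (k t - d * h t).
    by apply: is_derive_eq (is_deriveB (hd t) (is_derive_cst (e / d) t 1)) _; rewrite subr0.
  apply: is_derive_eq (is_deriveN (is_derive_expRM _ d _ _ hed)) _.
  by field; rewrite gt_eqF.
pose G := - g T.
have de : 0 < d * (e' - e / d) by rewrite mulrBr mulrCA divff ?mulr1 ?subr_gt0// gt_eqF.
near=> t.
have Tt : T < t by near: t; exact: nbhs_pinfty_gt.
have gT : g T <= g t.
  apply: derive_le (ltW Tt) gd _ => x Tx.
  by rewrite mulr_ge0 ?expR_ge0// subr_ge0 kT.
have Gt : G / (d * (e' - e / d)) < t by near: t; apply: nbhs_pinfty_gt; rewrite num_real.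
have : expR (d * t) * (h t - e / d) <= expR (d * t) * (e' - e / d).
  apply: (@le_trans _ _ G); first by rewrite /G lerNr.
  move: Gt; rewrite ltr_pdivrMr// => /ltW /le_trans; apply.
  have -> : t * (d * (e' - e / d)) = (d * t) * (e' - e / d) by ring.
  rewrite ler_pM2r; last by rewrite -(pmulr_rgt0 _ d0).
  by apply: le_trans (expR_ge1Dx _); rewrite lerDr.
by rewrite ler_pM2l ?expR_gt0// lerD2r.
Unshelve. all: by end_near. Qed.

Lemma ode_cvg h k (d c : R) : 0 < d ->
  (forall t, is_derive t (1 : R) h (k t - d * h t)) ->
  k t @[t --> +oo] --> c -> h t @[t --> +oo] --> c / d.
Proof.
move=> d0 hd kc; apply/cvgrPdist_le => e e0.
have de : d * (c / d) = c by rewrite mulrCA divff ?mulr1// gt_eqF.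
have eps0 : 0 < d * e / 2 by rewrite divr_gt0// mulr_gt0.
have epsl : d * e / 2 < d * e by rewrite ltr_pdivrMr// ltr_pMr ?mulr_gt0// ltr1n.
have /cvgrPdist_le/(_ _ eps0) knear := kc.
have upper : \forall t \near +oo, h t <= c / d + e.
  apply: (@ode_limsup _ k d (c + d * e / 2)) => //.
    by rewrite mulrDr de ltrD2l.
  by move: knear; apply: filterS => t kt; rewrite -lerBlDl (le_trans (ler_norm _))// distrC.
have lower : \forall t \near +oo, - h t <= e - c / d.
  apply: (@ode_limsup _ (fun t => - k t) d (d * e / 2 - c)) => //.
  - by rewrite mulrBr de ltrD2r.
  - by move=> t; apply: is_derive_eq (is_deriveN (hd t)) _; ring.
  - by move: knear; apply: filterS => t kt; rewrite lerBrDl (le_trans (ler_norm _)).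
move: upper lower; apply: filterS2 => t hu hl.
by rewrite ler_norml; apply/andP; split; lra.
Qed.

End LinearODE.

Section StateSpace.
Variable N : nat.
Implicit Types x y z : stT N.

Definition rank x : nat := ((x.1 : nat).*2 + x.2)%N.

Lemma st_eq x y : (x.1 : nat) = y.1 -> (x.2 : nat) = y.2 -> x = y.
Proof. by case: x y => [? ?] [? ?] /= /val_inj -> /val_inj ->. Qed.

Hypothesis N_gt0 : (1 <= N)%N.

Lemma xN1_1 : ((xN1 N).1 : nat) = N. Proof. by []. Qed.
Lemma xN1_2 : ((xN1 N).2 : nat) = 1%N. Proof. by rewrite /= inordK. Qed.
Lemma x02_1 : ((x02 N).1 : nat) = 0%N. Proof. by []. Qed.
Lemma x02_2 : ((x02 N).2 : nat) = 2%N. Proof. by rewrite /= inordK. Qed.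

Lemma xN1_Shat : xN1 N \in Shat N.
Proof. by rewrite inE /inShat xN1_1 xN1_2 !eqxx. Qed.

Lemma x02_Shat : x02 N \in Shat N.
Proof. by rewrite inE /inShat x02_1 x02_2; lia. Qed.

Lemma ShatP x : x \in Shat N -> x != xN1 N ->
  (2 <= x.2)%N /\ (x.1 + x.2 <= N.+1)%N.
Proof.
rewrite inE /inShat => /orP[/andP[/eqP x1 /eqP x2] /eqP[]|/andP[]//].
by apply: st_eq; rewrite ?xN1_1 ?xN1_2.
Qed.

Lemma rank_xN1 : rank (xN1 N) = N.*2.+1.
Proof. by rewrite /rank xN1_1 xN1_2 addn1. Qed.

Lemma rank_Shat_le x : x \in Shat N -> (rank x <= N.*2.+1)%N.
Proof.
have [->|xN /ShatP/(_ xN)] := eqVneq x (xN1 N); first by rewrite rank_xN1.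
rewrite /rank; lia.
Qed.

Lemma rank_Shat_gt1 x : x \in Shat N -> (2 <= rank x)%N.
Proof.
have [->|xN /ShatP/(_ xN)] := eqVneq x (xN1 N); first by rewrite rank_xN1; lia.
rewrite /rank; lia.
Qed.

Lemma Shat_ind (P : stT N -> Prop) : P (xN1 N) ->
  (forall y, y \in Shat N -> y != xN1 N ->
     (forall z, z \in Shat N -> rank z = (rank y).+1 -> P z) -> P y) ->
  forall y, y \in Shat N -> P y.
Proof.
move=> PN Pstep y; move En : (N.*2.+1 - rank y)%N => n.
elim: n y En => [|n IHn] y En yS; have [->//|yN] := eqVneq y (xN1 N);
  apply: Pstep => // z zS rz.
  by have := rank_Shat_le _ zS; lia.
by apply: IHn => //; have := rank_Shat_le _ zS; lia.
Qed.

End StateSpace.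

Section KilledSIR.
Variables (R : realType) (N : nat) (beta mu : R).
Hypotheses (N_gt0 : (1 <= N)%N) (beta_gt0 : 0 < beta) (mu_gt0 : 0 < mu).
Implicit Types (x y z : stT N) (rho nu u : stT N -> R).

Local Notation Q := (@Qk R N beta mu).
Local Notation Qn := (@Qpow R N beta mu).
Local Notation q := (@totrate R N beta mu).
Local Notation rt := (@rate R N beta mu).
Local Notation top := (xN1 N).
Local Notation bot := (x02 N).

Lemma rate_ge0 x y : 0 <= rt x y.
Proof.
by rewrite /rate; case: ifP => _; [|case: ifP => _ //]; rewrite !mulr_ge0 ?(ltW beta_gt0) ?(ltW mu_gt0).
Qed.

Lemma rate_rank x y : rt x y != 0 -> rank N x = (rank N y).+1.
Proof.
rewrite /rate /rank; case: ifP => [|_]; first lia.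
by case: ifP => [|_]; [lia | rewrite eqxx].
Qed.

Lemma infection_rate x y : (y.1.+1 = x.1 :> nat)%N -> (y.2 = x.2.+1 :> nat)%N ->
  (0 < x.2)%N -> 0 < rt x y.
Proof.
move=> e1 e2 x2; rewrite /rate e1 e2 !eqxx /= !mulr_gt0 ?ltr0n//.
by rewrite -e1.
Qed.

Lemma recovery_rate x y : (y.1 = x.1 :> nat)%N -> (y.2.+1 = x.2 :> nat)%N -> 0 < rt x y.
Proof.
move=> e1 e2; rewrite /rate e1 e2 !eqxx /=; case: ifP => [|_]; first lia.
by rewrite mulr_gt0 ?ltr0n// -e2.
Qed.

Lemma predecessor y : y \in Shat N -> y != top ->
  exists2 z, z \in Shat N & 0 < rt z y.
Proof.
move=> yS yN; have [y2 y12] := ShatP _ _ yS yN.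
have [E|E] := boolP (((y.2 : nat) == 2%N) && (y.1.+1 < N)%N).
  exists (y.1, inord 3); last by apply: recovery_rate => //=; rewrite inordK; lia.
  by rewrite inE /inShat /= inordK; lia.
exists (inord y.1.+1, inord y.2.-1).
  by rewrite inE /inShat /= !inordK; lia.
by apply: infection_rate => /=; rewrite !inordK; lia.
Qed.

Lemma successor x : x \in Shat N -> x != bot ->
  exists2 y, y \in Shat N & 0 < rt x y.
Proof.
move=> xS xb.
have xP : (1 <= x.2)%N /\ (x.1 + x.2 <= N.+1)%N /\ (x.1 = 0 :> nat -> 2 <= x.2)%N.
  have [->|xN] := eqVneq x top; first by rewrite xN1_1 xN1_2; lia.
  by have := ShatP _ _ xS xN; lia.
have [E|E] := boolP ((x.1 : nat) == 0%N).
  have x2 : (x.2 : nat) != 2%N.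
    apply: contra xb => /eqP x2; apply/eqP; apply: st_eq; rewrite ?x02_1 ?(x02_2 _ N_gt0)//.
    exact/eqP.
  exists (x.1, inord x.2.-1); last by apply: recovery_rate => //=; rewrite inordK; lia.
  by rewrite inE /inShat /= inordK; lia.
exists (inord x.1.-1, inord x.2.+1).
  by rewrite inE /inShat /= !inordK; lia.
by apply: infection_rate => /=; rewrite ?inordK; lia.
Qed.

Lemma totrate_top : q top = beta * N%:R + mu.
Proof. by rewrite /totrate xN1_1 xN1_2 mul1r. Qed.

Lemma totrate_bot : q bot = 2 * mu.
Proof. by rewrite /totrate x02_1 (x02_2 _ N_gt0) mulr0 add0r. Qed.

Lemma totrate_ge y : y \in Shat N -> y != top -> 2 * mu <= q y.
Proof.
move=> yS yN; have [y2 _] := ShatP _ _ yS yN.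
rewrite /totrate ler_pM ?ler_nat//; first exact: ltW.
by rewrite lerDr mulr_ge0 ?(ltW beta_gt0).
Qed.

Lemma totrate_gt y : y \in Shat N -> y != top -> y != bot -> 2 * mu < q y.
Proof.
move=> yS yN yb; have [y2 _] := ShatP _ _ yS yN.
rewrite /totrate; have [y1|y1] := posnP (y.1 : nat).
  rewrite y1 mulr0 add0r ltr_pM2r// ltr_nat ltn_neqAle y2 andbT.
  by apply: contra yb => /eqP E; apply/eqP/st_eq; rewrite ?x02_1 ?(x02_2 _ N_gt0).
apply: (@lt_le_trans _ _ (2 * (beta * (y.1 : nat)%:R + mu))).
  by rewrite ltr_pM2l// ltrDr mulr_gt0// ltr0n.
by rewrite ler_wpM2r ?ler_nat// addr_ge0 ?mulr_ge0 ?(ltW beta_gt0) ?(ltW mu_gt0).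
Qed.

Definition flow u y : R := \sum_(z in Shat N) u z * rt z y.

Lemma QkE u y : y \in Shat N -> \sum_z u z * Q z y = flow u y - q y * u y.
Proof.
move=> yS; rewrite (bigD1 y)//= /flow [in RHS](bigD1 y)//= {1}/Qk yS /= eqxx.
have -> : rt y y = 0.
  by apply/eqP/negPn/negP => /rate_rank; lia.
rewrite mulr0 add0r addrC mulrN (mulrC (u y)); congr (_ - _).
rewrite [RHS]big_mkcondl; apply: eq_bigr => z zy.
by rewrite /Qk yS andbT; case: ifP => _; rewrite ?mulr0 ?(negPf zy).
Qed.

Lemma eq_flow u v y :
  (forall z, z \in Shat N -> rank N z = (rank N y).+1 -> u z = v z) ->
  flow u y = flow v y.
Proof.
move=> uv; apply: eq_bigr => z zS.
by have [->|/rate_rank rz] := eqVneq (rt z y) 0; rewrite ?mulr0// uv.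
Qed.

Lemma flowZ (c : R) u y : flow (fun z => c * u z) y = c * flow u y.
Proof. by rewrite /flow mulr_sumr; apply: eq_bigr => z _; rewrite mulrA. Qed.

Lemma flow_top u : flow u top = 0.
Proof.
apply: big1 => z zS; have [->|/rate_rank] := eqVneq (rt z top) 0.
  by rewrite mulr0.
by have := rank_Shat_le _ N_gt0 _ zS; rewrite rank_xN1//; lia.
Qed.

Lemma flow_ge u y x : x \in Shat N ->
  (forall z, z \in Shat N -> rank N z = (rank N y).+1 -> 0 <= u z) ->
  u x * rt x y <= flow u y.
Proof.
move=> xS u0; rewrite /flow (bigD1 x)//= lerDl; apply: sumr_ge0 => z /andP[zS _].
have [->|/rate_rank rz] := eqVneq (rt z y) 0; first by rewrite mulr0.
by rewrite mulr_ge0 ?rate_ge0 ?u0.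
Qed.

Lemma flow_ge0 u y :
  (forall z, z \in Shat N -> rank N z = (rank N y).+1 -> 0 <= u z) ->
  0 <= flow u y.
Proof.
move=> u0; apply: sumr_ge0 => z zS.
have [->|/rate_rank rz] := eqVneq (rt z y) 0; first by rewrite mulr0.
by rewrite mulr_ge0 ?rate_ge0 ?u0.
Qed.

Lemma flow_gt0 u y : y \in Shat N -> y != top ->
  (forall z, z \in Shat N -> rank N z = (rank N y).+1 -> 0 < u z) ->
  0 < flow u y.
Proof.
move=> yS yN u0; have [z zS rz] := predecessor _ yS yN.
apply: (@lt_le_trans _ _ (u z * rt z y)); last first.
  by apply: flow_ge => // x xS rx; rewrite ltW// u0.
by rewrite mulr_gt0// u0//; apply: rate_rank; rewrite gt_eqF.
Qed.

Lemma Qpow_le k x y : `|Qn k x y| <= (\sum_x \sum_z `|Q x z|) ^+ k.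
Proof.
set M := \sum_x _; have M0 : 0 <= M by do 2 (apply: sumr_ge0 => ? _).
elim: k x => [|k IHk] x /=; first by case: (x == y); rewrite ?normr1 ?normr0.
apply: le_trans (ler_norm_sum _ _ _) _.
apply: (@le_trans _ _ (\sum_z `|Q x z| * M ^+ k)).
  by apply: ler_sum => z _; rewrite normrM ler_wpM2l.
rewrite -mulr_suml exprS ler_wpM2r ?exprn_ge0// [leRHS](bigD1 x)//= lerDl.
by do 2 (apply: sumr_ge0 => ? _).
Qed.

Lemma Qpow_bounded x y : geom_bounded R (fun k => Qn k x y).
Proof. by exists 1, (\sum_x \sum_z `|Q x z|) => k; rewrite mul1r Qpow_le. Qed.

Lemma QpowSr k x y : Qn k.+1 x y = \sum_z Qn k x z * Q z y.
Proof.
elim: k x => [|k IHk] x.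
  rewrite /= (bigD1 y)//= eqxx mulr1 big1 ?addr0; last first.
    by move=> z /negPf ->; rewrite mulr0.
  rewrite (bigD1 x)//= eqxx mul1r big1 ?addr0// => z.
  by rewrite eq_sym => /negPf ->; rewrite mul0r.
rewrite -/(Qn k.+2 x y) [LHS]/=.
under eq_bigr => z _ do rewrite -/(Qn k.+1 z y) IHk mulr_sumr.
rewrite exchange_big; apply: eq_bigr => z _ /=.
by rewrite mulr_suml; apply: eq_bigr => w _; rewrite mulrA.
Qed.

(* [rho Q^k], whose exponential generating function is the law [rho exp(tQ)]
   of the killed process started from [rho]. *)
Definition mom rho k y : R := \sum_x rho x * Qn k x y.
Definition law rho t y : R := egf R (fun k => mom rho k y) t.

Lemma mom0 rho y : mom rho 0 y = rho y.
Proof.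
rewrite /mom (bigD1 y)//= eqxx mulr1 big1 ?addr0// => z.
by move=> /negPf ->; rewrite mulr0.
Qed.

Lemma momS rho k y : mom rho k.+1 y = \sum_z mom rho k z * Q z y.
Proof.
rewrite /mom; under eq_bigr => x _ do rewrite QpowSr mulr_sumr.
rewrite exchange_big; apply: eq_bigr => z _ /=.
by rewrite mulr_suml; apply: eq_bigr => w _; rewrite mulrA.
Qed.

Lemma mom_bounded rho y : geom_bounded R (fun k => mom rho k y).
Proof.
exists (\sum_x `|rho x|), (\sum_x \sum_z `|Q x z|) => k.
apply: le_trans (ler_norm_sum _ _ _) _; rewrite mulr_suml.
by apply: ler_sum => x _; rewrite normrM ler_wpM2l// Qpow_le.
Qed.

Lemma lawE rho t y : law rho t y = \sum_x rho x * Pk beta mu t x y.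
Proof. by rewrite /law /mom egf_sum// => x; apply: Qpow_bounded. Qed.

Lemma is_derive_law rho t y : y \in Shat N ->
  is_derive t (1 : R) (law rho ^~ y) (flow (law rho t) y - q y * law rho t y).
Proof.
move=> yS; apply: is_derive_eq (is_derive_egf _ _ t (mom_bounded rho y)) _.
rewrite -QkE// (_ : (fun k => _) = (fun k => \sum_z Q z y * mom rho k z)).
  rewrite egf_sum; last by move=> z; apply: mom_bounded.
  by apply: eq_bigr => z _; rewrite mulrC.
by apply/funext => k; rewrite momS; apply: eq_bigr => z _; rewrite mulrC.
Qed.

Lemma law_geom rho (c t : R) y :
  (forall k, mom rho k y = rho y * c ^+ k) -> law rho t y = rho y * expR (c * t).
Proof.
by move=> E; rewrite /law -egf_geom; congr (egf _ _ t); apply/funext.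
Qed.

Lemma law0 rho y : law rho 0 y = rho y.
Proof.
rewrite lawE -[RHS]mom0; apply: eq_bigr => x _; congr (_ * _).
apply: (@cvg_lim R) => //; rewrite -(cvg_shiftS (fun n : nat => _)) /=.
rewrite (_ : (fun n => _) = cst (Qn 0 x y)); first exact: cvg_cst.
apply/funext => n; rewrite big_ord_recl big1 /= ?addr0 => [|i _].
  by rewrite expr0 fact0 divr1 mul1r.
by rewrite expr0n /= mul0r mul0r.
Qed.

Lemma law_top rho t : law rho t top = rho top * expR (- q top * t).
Proof.
apply: law_geom; elim=> [|k IHk]; first by rewrite mom0 expr0 mulr1.
rewrite momS QkE ?xN1_Shat// flow_top IHk exprS; ring.
Qed.

Definition left_eigen nu :=
  forall y, y \in Shat N -> flow nu y = (q y - q top) * nu y.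

Lemma law_eigen nu t y : (forall x, x \notin Shat N -> nu x = 0) ->
  left_eigen nu -> law nu t y = nu y * expR (- q top * t).
Proof.
move=> nuS nuE; apply: law_geom => k; elim: k y => [|k IHk] y.
  by rewrite mom0 expr0 mulr1.
rewrite momS; have [yS|yS] := boolP (y \in Shat N).
  rewrite QkE// (eq_flow _ (fun z => (- q top) ^+ k * nu z)).
    by rewrite flowZ nuE// IHk exprS; ring.
  by move=> z _ _; rewrite IHk mulrC.
rewrite nuS// mul0r big1// => z _.
by rewrite /Qk (negPf yS) andbF mulr0.
Qed.

Lemma condPE rho t (A : {set stT N}) : (forall x, x \notin Shat N -> rho x = 0) ->
  condP beta mu rho t A =
  (\sum_(y in A) law rho t y) / (\sum_(y in Shat N) law rho t y).
Proof.
move=> rhoS; rewrite /condP.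
suff E (B : {set stT N}) :
    \sum_(x in Shat N) rho x * (\sum_(y in B) Pk beta mu t x y) =
    \sum_(y in B) law rho t y by rewrite !E.
under [RHS]eq_bigr do rewrite lawE.
rewrite [RHS]exchange_big /= [LHS]big_mkcond; apply: eq_bigr => x _.
case: ifPn => [_|/rhoS ->]; first by rewrite mulr_sumr.
by rewrite big1// => y _; rewrite mul0r.
Qed.

Definition scaled (a : R) rho t y : R := expR (a * t) * law rho t y.

Lemma condP_scaled (a : R) rho t y : (forall x, x \notin Shat N -> rho x = 0) ->
  condP beta mu rho t [set y] =
  scaled a rho t y / (\sum_(z in Shat N) scaled a rho t z).
Proof.
move=> rhoS; rewrite condPE// big_set1 /scaled -mulr_sumr invfM mulrACA.
by rewrite divff ?mul1r// gt_eqF// expR_gt0.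
Qed.

Lemma scaled0 a rho y : scaled a rho 0 y = rho y.
Proof. by rewrite /scaled mulr0 expR0 mul1r law0. Qed.

Lemma scaled_top rho t : scaled (q top) rho t top = rho top.
Proof. by rewrite /scaled law_top mulrCA -expRD mulNr subrr expR0 mulr1. Qed.

Lemma is_derive_scaled a rho t y : y \in Shat N ->
  is_derive t (1 : R) (scaled a rho ^~ y)
    (flow (scaled a rho t) y - (q y - a) * scaled a rho t y).
Proof.
move=> yS; apply: is_derive_eq (is_derive_expRM _ _ a _ _ (is_derive_law rho t y yS)) _.
by rewrite /scaled flowZ; ring.
Qed.

Lemma scaled_cvg a rho u y : y \in Shat N -> a < q y ->
  (forall z, z \in Shat N -> rank N z = (rank N y).+1 ->
     scaled a rho t z @[t --> +oo%R] --> u z) ->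
  scaled a rho t y @[t --> +oo%R] --> flow u y / (q y - a).
Proof.
move=> yS ay uz; apply: (ode_cvg _ _ (fun t => flow (scaled a rho t) y)).
- by rewrite subr_gt0.
- by move=> t; apply: is_derive_scaled.
- apply: cvg_big => [|z zS]; first exact: add_continuous.
  have [->|/rate_rank rz] := eqVneq (rt z y) 0.
    by under eq_fun do rewrite mulr0; rewrite mulr0; exact: cvg_cst.
  by apply: cvgM; [exact: uz | exact: cvg_cst].
Qed.

Lemma eigen_cvg rho nu y : q top < 2 * mu -> left_eigen nu -> nu top != 0 ->
  y \in Shat N ->
  scaled (q top) rho t y @[t --> +oo%R] --> rho top / nu top * nu y.
Proof.
move=> topmu nuE nu0; move: y; apply: Shat_ind => //.
  under eq_fun do rewrite scaled_top.
  by rewrite divfK//; exact: cvg_cst.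
move=> y yS yN IH.
have qy : q top < q y by apply: lt_le_trans topmu _; exact: totrate_ge.
have := scaled_cvg _ _ _ _ yS qy IH.
rewrite flowZ nuE// [_ * nu y]mulrC mulrA mulfK//.
by rewrite subr_eq0 gt_eqF.
Qed.

Lemma eigen_condP_cvg rho nu y : q top < 2 * mu ->
  isProbShat rho -> isProbShat nu -> left_eigen nu -> 0 < rho top -> 0 < nu top ->
  y \in Shat N -> condP beta mu rho t [set y] @[t --> +oo%R] --> nu y.
Proof.
move=> topmu [_ [rhoS _]] [_ [_ nu1]] nuE rho0 nu0 yS.
under eq_fun do rewrite (condP_scaled (q top))//.
have c0 : rho top / nu top != 0 by rewrite mulf_neq0 ?invr_neq0 ?gt_eqF.
have cv z : z \in Shat N ->
    scaled (q top) rho t z @[t --> +oo%R] --> rho top / nu top * nu z.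
  by move=> zS; apply: eigen_cvg => //; rewrite gt_eqF.
have -> : nu y = (rho top / nu top * nu y) /
    \sum_(z in Shat N) rho top / nu top * nu z.
  by rewrite -mulr_sumr nu1 mulr1 mulrAC divff ?mul1r.
apply: cvgM; first exact: cv.
apply: cvgV; first by rewrite -mulr_sumr nu1 mulr1.
by apply: cvg_big => //; exact: add_continuous.
Qed.

Lemma eigen_isQSD nu : isProbShat nu -> left_eigen nu -> isQSD beta mu nu.
Proof.
move=> nuP nuE; split=> // t _ A _; have [_ [nuS nu1]] := nuP.
rewrite condPE//; under eq_bigr do rewrite law_eigen//.
under [X in _ / X]eq_bigr do rewrite law_eigen//.
by rewrite -!mulr_suml nu1 mul1r mulfK// gt_eqF// expR_gt0.
Qed.

Lemma isQSD_eigen nu : isQSD beta mu nu -> 0 < nu top -> left_eigen nu.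
Proof.
move=> [nuP nuQ] nu0 y yS; have [_ [nuS _]] := nuP.
have ratio t z : 0 <= t -> z \in Shat N ->
    scaled (q top) nu t z / (\sum_(x in Shat N) scaled (q top) nu t x) = nu z.
  by move=> t0 zS; rewrite -condP_scaled// nuQ ?finset.sub1set// big_set1.
have mass1 t : 0 <= t -> \sum_(x in Shat N) scaled (q top) nu t x = 1.
  move=> t0; have := ratio t top t0 (xN1_Shat _).
  rewrite scaled_top => /(congr1 (fun r => (nu top)^-1 * r)).
  by rewrite mulKf ?mulVf ?gt_eqF// => /(congr1 GRing.inv); rewrite invrK invr1.
have const t z : 0 <= t -> z \in Shat N -> scaled (q top) nu t z = nu z.
  by move=> t0 zS; rewrite -[RHS](ratio t)// mass1// divr1.
have [c c0] := MVT_derive _ _ _ _ _ (ltr01) (fun t => is_derive_scaled (q top) nu t y yS).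
rewrite !const// ?ltW// subrr subr0 mulr1 => /esym/eqP; rewrite subr_eq0 => /eqP <-.
by apply: eq_flow => z zS _; rewrite const// ltW.
Qed.

Lemma eigen_pos nu : (forall x, 0 <= nu x) -> left_eigen nu -> 0 < nu top ->
  forall y, y \in Shat N -> 0 < nu y.
Proof.
move=> nu0 nuE nutop; apply: Shat_ind => // y yS yN IH.
have := flow_gt0 _ _ yS yN IH; rewrite nuE// [in X in _ -> X]lt_neqAle nu0 andbT.
by apply: contraTneq => <-; rewrite mulr0 ltxx.
Qed.

Lemma eigen_totrate nu : (forall x, 0 <= nu x) -> left_eigen nu -> 0 < nu top ->
  q top < 2 * mu.
Proof.
move=> nu0 nuE nutop; have pos := eigen_pos _ nu0 nuE nutop.
have bN : bot != top.
  by apply/eqP => /(congr1 (fun x => nat_of_ord x.2)); rewrite x02_2// xN1_2.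
have bS := x02_Shat _ N_gt0.
have := flow_gt0 nu bot bS bN (fun z zS _ => pos z zS).
by rewrite nuE// pmulr_lgt0 ?pos// subr_gt0 totrate_bot.
Qed.

(* Solves the triangular eigenvector equation; [n] is the number of ranks
   between the state and the top one. *)
Fixpoint eigen_rec (n : nat) y : R :=
  if y == top then 1 else
  if n is n'.+1 then flow (eigen_rec n') y / (q y - q top) else 0.

Definition eigenvector y : R :=
  if y \in Shat N then eigen_rec (N.*2.+1 - rank N y) y else 0.

Lemma eigenvector_eigen : q top < 2 * mu -> left_eigen eigenvector.
Proof.
move=> topmu y yS; have [->|yN] := eqVneq y top.
  by rewrite flow_top subrr mul0r.
have ry : (rank N y < N.*2.+1)%N by have := ShatP _ _ yS yN; rewrite /rank; lia.
have qy : q top < q y by apply: lt_le_trans topmu _; exact: totrate_ge.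
rewrite {2}/eigenvector yS; case E : (N.*2.+1 - rank N y)%N => [|n]; first lia.
rewrite /= (negPf yN) mulrC divfK ?subr_eq0 ?gt_eqF//.
apply: eq_flow => z zS rz; rewrite /eigenvector zS; congr eigen_rec; lia.
Qed.

Lemma eigenvector_top : eigenvector top = 1.
Proof. by rewrite /eigenvector xN1_Shat; case: (_ - _)%N => [|n] /=; rewrite eqxx. Qed.

Lemma eigenvector_gt0 y : q top < 2 * mu -> y \in Shat N -> 0 < eigenvector y.
Proof.
move=> topmu; move: y; apply: Shat_ind => //; first by rewrite eigenvector_top.
move=> y yS yN IH.
have qy : q top < q y by apply: lt_le_trans topmu _; exact: totrate_ge.
by have := flow_gt0 _ _ yS yN IH; rewrite eigenvector_eigen// pmulr_rgt0 ?subr_gt0.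
Qed.

Lemma eigen_prob_exists : q top < 2 * mu ->
  exists nu, [/\ isProbShat nu, left_eigen nu & 0 < nu top].
Proof.
move=> topmu; pose W := \sum_(y in Shat N) eigenvector y.
have W0 : 0 < W.
  rewrite /W (bigD1 top) ?xN1_Shat//= ltr_pwDl ?eigenvector_top//.
  by apply: sumr_ge0 => z /andP[zS _]; rewrite ltW// eigenvector_gt0.
exists (fun y => W^-1 * eigenvector y); split; last by rewrite eigenvector_top mulr1 invr_gt0.
- split=> [x|]; last split=> [x xS|]; last by rewrite -mulr_sumr mulVf// gt_eqF.
    rewrite mulr_ge0 ?invr_ge0 ?(ltW W0)//; have [xS|xS] := boolP (x \in Shat N).
      by rewrite ltW// eigenvector_gt0.
    by rewrite /eigenvector (negPf xS).
  by rewrite /eigenvector (negPf xS) mulr0.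
- by move=> y yS; rewrite flowZ eigenvector_eigen// mulrCA.
Qed.

Lemma scaled_ge0 a rho t y : (forall x, 0 <= rho x) -> 0 <= t ->
  y \in Shat N -> 0 <= scaled a rho t y.
Proof.
move=> rho0 t0 yS; rewrite mulr_ge0 ?expR_ge0//; move: y yS t t0.
apply: Shat_ind => // [t _|y yS yN IH t t0]; first by rewrite law_top mulr_ge0 ?expR_ge0.
rewrite -(pmulr_rge0 _ (expR_gt0 (q y * t))).
apply: le_trans (_ : scaled (q y) rho 0 y <= _); first by rewrite scaled0.
apply: derive_le t0 (fun s => is_derive_scaled (q y) rho s y yS) _ => s s0.
rewrite subrr mul0r subr0; apply: flow_ge0 => z zS rz.
by rewrite mulr_ge0 ?expR_ge0// IH// ltW.
Qed.

Lemma scaled_mono rho (s t : R) y : (forall x, 0 <= rho x) -> 0 <= s <= t ->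
  y \in Shat N -> scaled (q y) rho s y <= scaled (q y) rho t y.
Proof.
move=> rho0 /andP[s0 st] yS.
apply: derive_le st (fun r => is_derive_scaled (q y) rho r y yS) _ => r sr.
rewrite subrr mul0r subr0; apply: flow_ge0 => z zS _.
by apply: scaled_ge0 => //; apply: ltW; apply: le_lt_trans s0 sr.
Qed.

Lemma law_bot_gt0 rho x : (forall x, 0 <= rho x) -> x \in Shat N ->
  (forall t, 0 < t -> 0 < law rho t x) -> forall t, 0 < t -> 0 < law rho t bot.
Proof.
move=> rho0; move En : (rank N x) => n; elim: n x En => [|n IHn] x En xS pos.
  by have := rank_Shat_gt1 _ N_gt0 _ xS; rewrite En.
have [<-//|xb] := eqVneq x bot.
have [y yS ry] := successor _ xS xb.
apply: (IHn y) => //; first by have := rate_rank x y; rewrite gt_eqF// => /(_ isT); lia.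
move=> t t0; rewrite -(pmulr_rgt0 _ (expR_gt0 (q y * t))).
apply: (@le_lt_trans _ _ (scaled (q y) rho 0 y)); first by rewrite scaled0.
apply: derive_lt t0 (fun s => is_derive_scaled (q y) rho s y yS) _ => s s0.
rewrite subrr mul0r subr0.
apply: (@lt_le_trans _ _ (scaled (q y) rho s x * rt x y)).
  by rewrite !mulr_gt0 ?expR_gt0// pos.
by apply: flow_ge => // z zS _; apply: scaled_ge0 => //; exact: ltW.
Qed.

Lemma law_start_gt0 rho x t : (forall x, 0 <= rho x) -> x \in Shat N ->
  0 < rho x -> 0 <= t -> 0 < law rho t x.
Proof.
move=> rho0 xS rx t0; rewrite -(pmulr_rgt0 _ (expR_gt0 (q x * t))).
apply: (@lt_le_trans _ _ (scaled (q x) rho 0 x)); first by rewrite scaled0.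
by apply: scaled_mono; rewrite ?lexx.
Qed.

Lemma no_top_condP_cvg rho y : isProbShat rho -> rho top = 0 -> y \in Shat N ->
  condP beta mu rho t [set y] @[t --> +oo%R] --> ((y == bot)%:R : R).
Proof.
move=> [rho0 [rhoS rho1]] rhotop yS.
have bS := x02_Shat _ N_gt0.
pose F := scaled (q bot) rho.
pose D t := \sum_(z in Shat N) F t z.
have F0 t z : 0 <= t -> z \in Shat N -> 0 <= F t z by exact: scaled_ge0.
have [x xS rx] : exists2 x, x \in Shat N & 0 < rho x.
  apply: contrapT => none.
  have : \sum_(x in Shat N) rho x = 0.
    apply: big1 => x xS; apply/eqP; rewrite eq_le rho0 andbT leNgt.
    by apply/negP => rx; apply: none; exists x.
  by rewrite rho1 => /eqP; rewrite oner_eq0.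
have Fbot : 0 < F 1 bot.
  rewrite mulr_gt0 ?expR_gt0//; apply: (law_bot_gt0 _ _ rho0 xS) => // t t0.
  by apply: law_start_gt0 => //; exact: ltW.
have DF t : 1 <= t -> F 1 bot <= D t.
  move=> t1; apply: (@le_trans _ _ (F t bot)).
    by apply: scaled_mono; rewrite ?ler01.
  rewrite /D (bigD1 bot)//= lerDl; apply: sumr_ge0 => z /andP[zS _].
  by rewrite F0// (le_trans ler01).
have Fcvg z : z \in Shat N -> z != bot -> F t z @[t --> +oo%R] --> (0 : R).
  move: z; apply: Shat_ind => // [_|z zS zN IH zb].
    rewrite /F /scaled; under eq_fun do rewrite law_top rhotop mul0r mulr0.
    exact: cvg_cst.
  rewrite -(mul0r (q z - q bot)^-1).
  have -> : 0 = flow (fun=> 0) z by rewrite /flow big1// => ? _; rewrite mul0r.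
  apply: scaled_cvg => //; first by rewrite totrate_bot totrate_gt.
  move=> w wS rw; apply: IH => //; apply/eqP => wb.
  have := rank_Shat_gt1 _ N_gt0 _ zS; move: rw.
  by rewrite wb /rank x02_1 x02_2//; lia.
have pcvg z : z \in Shat N -> z != bot -> F t z / D t @[t --> +oo%R] --> (0 : R).
  move=> zS zb; apply: (@squeeze_cvgr _ _ _ _ (cst 0) (fun t => F t z / F 1 bot)).
  - near=> t; have t1 : 1 <= t by near: t; exact: nbhs_pinfty_ge.
    have t0 : 0 <= t by rewrite (le_trans ler01).
    have D0 : 0 < D t by rewrite (lt_le_trans Fbot) ?DF.
    by rewrite divr_ge0 ?F0 ?(ltW D0)//= ler_wpM2l ?F0// lef_pV2 ?posrE// DF.
  - exact: cvg_cst.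
  - by rewrite -(mul0r (F 1 bot)^-1); apply: cvgM; [exact: Fcvg | exact: cvg_cst].
under eq_fun do rewrite (condP_scaled (q bot))//.
have [->|yb] := eqVneq y bot; last exact: pcvg.
have : 1 - \sum_(z in Shat N | z != bot) F t z / D t @[t --> +oo%R] --> (1 : R).
  rewrite -[X in _ --> X]subr0; apply: cvgB; first exact: cvg_cst.
  rewrite [X in _ --> X](_ : 0 = \sum_(z in Shat N | z != bot) 0); last by rewrite big1.
  by apply: cvg_big => [|z /andP[zS zb]]; [exact: add_continuous | exact: pcvg].
apply: cvg_trans; apply: near_eq_cvg; near=> t.
have t1 : 1 <= t by near: t; exact: nbhs_pinfty_ge.
have D0 : 0 < D t by rewrite (lt_le_trans Fbot) ?DF.
have : \sum_(z in Shat N) F t z / D t = 1 by rewrite -mulr_suml divff ?gt_eqF.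
by rewrite (bigD1 bot)//= => <-; rewrite addrK.
Unshelve. all: by end_near. Qed.

End KilledSIR.

Theorem mainTheorem7 (R : realType) (N : nat) (beta mu : R) :
  (1 <= N)%N -> 0 < beta -> 0 < mu ->
  [/\ ((exists nu : stT N -> R, isQSD beta mu nu /\ 0 < nu (xN1 N))
        <-> beta * N%:R < mu),
      (beta * N%:R < mu ->
        exists nu : stT N -> R,
          [/\ isQSD beta mu nu, 0 < nu (xN1 N),
              (forall nu' : stT N -> R, isQSD beta mu nu' -> 0 < nu' (xN1 N) ->
                 forall x, nu' x = nu x),
              (forall x, x \in Shat N -> 0 < nu x) &
              (forall y, y \in Shat N ->
                 condP beta mu (@dirac_st R N (xN1 N)) t [set y] @[t --> +oo%R]
                   --> nu y)]) &
      (forall rho : stT N -> R, isProbShat rho -> rho (xN1 N) = 0 ->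
         forall y, y \in Shat N ->
           condP beta mu rho t [set y] @[t --> +oo%R] --> ((y == x02 N)%:R : R))].
Proof.
move=> N0 b0 m0.
have critE : (totrate beta mu (xN1 N) < 2 * mu) = (beta * N%:R < mu).
  by rewrite totrate_top mulr_natl mulr2n ltrD2r.
split; first split.
- move=> [nu [nuQ nu0]]; rewrite -critE; have [[nu_ge0 _] _] := nuQ.
  apply: (eigen_totrate _ _ _ _ _ _ _ nu) => //.
  exact: isQSD_eigen.
- rewrite -critE => crit.
  have [//|||nu [nuP nuE nu0]] := @eigen_prob_exists R N beta mu _ _ _ crit => //.
  by exists nu; split=> //; apply: eigen_isQSD.
- rewrite -critE => crit.
  have [//|||nu [nuP nuE nu0]] := @eigen_prob_exists R N beta mu _ _ _ crit => //.
  have [nu_ge0 [nuS _]] := nuP.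
  exists nu; split=> //; first exact: eigen_isQSD.
  + move=> nu' [nu'P nu'Q] nu'0 x; have [_ [nu'S _]] := nu'P.
    have [xS|xS] := boolP (x \in Shat N); last by rewrite nuS ?nu'S.
    have cv : condP beta mu nu' t [set x] @[t --> +oo%R] --> nu x by apply: eigen_condP_cvg.
    apply/esym; rewrite -(cvg_lim _ cv)//; apply: (@cvg_lim R) => //.
    apply: cvg_trans (_ : cst (nu' x) @ +oo%R --> nu' x); last exact: cvg_cst.
    apply: near_eq_cvg; near=> t.
    have t0 : 0 <= t by near: t; exact: nbhs_pinfty_ge.
    by rewrite nu'Q ?finset.sub1set ?big_set1.
  + by move=> x xS; apply: (@eigen_pos R N beta mu).
  + move=> y yS; apply: eigen_condP_cvg => //; last by rewrite /dirac_st eqxx.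
    split=> [x|]; first by rewrite /dirac_st.
    split=> [x xS|]; rewrite /dirac_st.
      by case: eqP xS => // ->; rewrite xN1_Shat.
    rewrite (bigD1 (xN1 N)) ?xN1_Shat//= eqxx big1 ?addr0// => z /andP[_ /negPf ->].
    by [].
- by move=> rho rhoP rho0 y yS; apply: no_top_condP_cvg.
Unshelve. all: by end_near. Qed.
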